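(* The edge-fair rule is group strategyproof: for every bipartite graph $G$ and edge capacities $u$, the mechanism that collects the reported peaks $(s,d)$ of the suppliers and demanders and implements the edge-fair flow of the problem $(G,s,d,u)$ is group strategyproof for the agents located on the nodes.
   Context: **Problems and flows.** A problem $(G,s,d,u)$ consists of a finite bipartite graph $G=(S\cup D,E)$ with suppliers $S$, demanders $D$ and edges $E\subseteq S\times D$; numbers $s_i\ge 0$ ($i\in S$), $d_j\ge 0$ ($j\in D$); and edge capacities $u_{ij}\in[0,\infty]$. A flow $\varphi=(\varphi_{ij})_{(i,j)\in E}$ has nonnegative entries and induces net transfers $x_i(\varphi)=\sum_{j:(i,j)\in E}\varphi_{ij}$ ($i\in S$) and $y_j(\varphi)=\sum_{i:(i,j)\in E}\varphi_{ij}$ ($j\in D$). It is feasible if $0\le\varphi_{ij}\le u_{ij}$, $x_i(\varphi)\le s_i$, $y_j(\varphi)\le d_j$ for all $i,j$. $\mathcal F^*(G,s,d,u)$ is the set of maximum flows, i.e. feasible flows maximizing $\sum_{i\in S}x_i(\varphi)$. **Edge-fair rule.** Let $E_0=E$ and $\mathcal F_0=\mathcal F^*(G,s,d,u)$. At step $t=0,1,2,\dots$, as long as $E_t\ne\emptyset$, let $\lambda^*_{t+1}$ be the optimal value of $\max_{\varphi\in\mathcal F_t}\{\lambda_{t+1}:\varphi_e\ge\lambda_{t+1}\ \forall e\in E_t\}$, and set $\mathcal F_{t+1}=\{\varphi\in\mathcal F_t:\varphi_e\ge\lambda^*_{t+1}\ \forall e\in E_t\}$ and $E_{t+1}=\{e\in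 E_t:\varphi_e>\lambda^*_{t+1}\text{ for some }\varphi\in\mathcal F_{t+1}\}$. The output is the unique flow remaining when no active edge is left. Equivalently, it is the unique maximum flow whose vector of edge-flows, sorted in increasing order, is lexicographically largest among all maximum flows. **Agents.** Each supplier $i$ (demander $j$) is an agent with a single-peaked preference relation over its own net transfer in $\mathbb R_+$ with peak $s_i$ ($d_j$): strict preference strictly increases up to the peak and strictly decreases beyond it. $\mathcal R$ is the set of single-peaked preferences on $\mathbb R_+$. $G$ and $u$ are fixed and known; agents report preferences, of which the mechanism uses only the peaks. **Group strategyproofness.** For every preference profile $R\in\mathcal R^{S\cup D}$, every coalition $A\subseteq S\cup D$ and every joint misreport $R'_A\in\mathcal R^A$, if every agent in $A$ weakly prefers (according to its true preference in $R$) its net transfer at $(R'_A,R_{-A})$ to its net transfer at $R$, then every agent in $A$ is indifferent between the two. That is, no coalition can misreport so that all its members are weakly better off and at least one is strictly better off. *)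

(* Defs.v *)
(* MathComp-Analysis. *)
From HB Require Import structures.
From mathcomp Require Import all_boot all_order all_algebra.
From mathcomp Require Import boolp classical_sets reals constructive_ereal.

Set Implicit Arguments.
Unset Strict Implicit.
Unset Printing Implicit Defensive.

Import Order.TTheory GRing.Theory Num.Theory.
Local Open Scope classical_set_scope.
Local Open Scope ring_scope.

(* A bipartite graph is an edge set E : {set S * D}; flows and capacities are
   indexed by the edges themselves, not by all pairs in S * D. *)
Definition edge (S D : finType) (E : {set S * D}) : finType :=
  {e : S * D | e \in E}.

Section Flows.
Variables (R : realType) (S D : finType) (E : {set S * D}).

Definition flow : Type := {ffun edge E -> R}.

Implicit Types (s : S -> R) (d : D -> R) (u : edge E -> \bar R) (phi : flow).

Definition supplied phi (i : S) : R := \sum_(e : edge E | (val e).1 == i) phi e.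

Definition received phi (j : D) : R := \sum_(e : edge E | (val e).2 == j) phi e.

Definition feasible s d u phi : Prop :=
  [/\ forall e, 0 <= phi e,
      forall e, ((phi e)%:E <= u e)%E,
      forall i, supplied phi i <= s i &
      forall j, received phi j <= d j].

Definition max_flows s d u : set flow :=
  [set phi | feasible s d u phi /\
     forall psi, feasible s d u psi ->
       \sum_(i : S) supplied psi i <= \sum_(i : S) supplied phi i].

(* The optimal value of the step's linear program, as a supremum over the
   admissible levels. *)
Definition edge_level (F : set flow) (A : {set edge E}) : R :=
  sup [set l | exists2 phi, F phi & forall e, e \in A -> l <= phi e].

Definition next_flows (F : set flow) (A : {set edge E}) : set flow :=
  [set phi | F phi /\ forall e, e \in A -> edge_level F A <= phi e].

Definition next_edges (F : set flow) (A : {set edge E}) : {set edge E} :=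
  [set e in A |
     `[< exists2 phi, next_flows F A phi & edge_level F A < phi e >]]%SET.

(* The state (F_t, E_t); it is left unchanged once no edge is active. *)
Fixpoint edge_fair_state s d u (t : nat) : set flow * {set edge E} :=
  if t is t'.+1 then
    let: (F, A) := edge_fair_state s d u t' in
    if A == finset.set0 then (F, A) else (next_flows F A, next_edges F A)
  else (max_flows s d u, [set: edge E]%SET).

Definition edge_fair_output s d u : set flow :=
  [set phi | exists t, (edge_fair_state s d u t).2 = finset.set0 /\
                       (edge_fair_state s d u t).1 phi].

(* For nonnegative data edge_fair_output is a singleton, so the default value
   [ffun=> 0] is not used. *)
Definition edge_fair_flow s d u : flow :=
  xget [ffun=> 0] (edge_fair_output s d u).

End Flows.

(* Preferences on the nonnegative reals: sp_weak x y reads "x is at least as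
   good as y" and is only constrained for x, y >= 0. The two monotonicity
   conditions determine the peak from the relation. *)
Record sp_pref (R : realType) := SpPref {
  sp_weak : R -> R -> Prop;
  sp_peak : R;
  sp_peak_ge0 : 0 <= sp_peak;
  sp_total : forall x y, 0 <= x -> 0 <= y -> sp_weak x y \/ sp_weak y x;
  sp_trans : forall x y z, 0 <= x -> 0 <= y -> 0 <= z ->
    sp_weak x y -> sp_weak y z -> sp_weak x z;
  sp_below_peak : forall x y, 0 <= x -> x < y -> y <= sp_peak ->
    sp_weak y x /\ ~ sp_weak x y;
  sp_above_peak : forall x y, sp_peak <= x -> x < y ->
    sp_weak x y /\ ~ sp_weak y x
}.

Definition sp_indiff (R : realType) (P : sp_pref R) (x y : R) : Prop :=
  sp_weak P x y /\ sp_weak P y x.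

Definition profile (R : realType) (N : finType) : Type := N -> sp_pref R.

(* The profile (Q_A, P_{-A}). *)
Definition deviate (R : realType) (N : finType) (A : {set N})
    (Q P : profile R N) : profile R N :=
  fun a => if a \in A then Q a else P a.

Definition group_strategyproof (R : realType) (N : finType)
    (transfer : profile R N -> N -> R) : Prop :=
  forall (P Q : profile R N) (A : {set N}),
    (forall a, a \in A ->
       sp_weak (P a) (transfer (deviate A Q P) a) (transfer P a)) ->
    forall a, a \in A ->
      sp_indiff (P a) (transfer (deviate A Q P) a) (transfer P a).

Definition edge_fair_transfer (R : realType) (S D : finType)
    (E : {set S * D}) (u : edge E -> \bar R)
    (P : profile R (S + D)%type) (a : S + D) : R :=
  let phi := edge_fair_flow (fun i => sp_peak (P (inl i)))
                            (fun j => sp_peak (P (inr j))) u in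
  match a with
  | inl i => supplied phi i
  | inr j => received phi j
  end.

(* Main.v *)
Require Import Defs.
From HB Require Import structures.
From mathcomp Require Import all_boot all_order all_algebra.
From mathcomp Require Import boolp classical_sets reals constructive_ereal.
From mathcomp Require Import lra.
From mathcomp Require Import topology normedtype derive.

Set Implicit Arguments.
Unset Strict Implicit.
Unset Printing Implicit Defensive.

Import Order.TTheory GRing.Theory Num.Theory.
Import numFieldNormedType.Exports.
Local Open Scope ring_scope.
Local Open Scope classical_set_scope.

(** Let phi be the edge-fair flow at the truth and psi the one after a
misreport by which nobody in the coalition loses. The edge-fair rule never
gives an agent more than its reported peak, so true transfers lie at or below
true peaks, and comparing the two outcomes agent by agent shows
- an agent who gets more in psi is strictly below its true peak in phi;
- an agent who gets less in psi is outside the coalition, hence strictly below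
  its unchanged reported peak in psi
(lemma [sp_slack]). These two facts already force phi = psi
(lemma [edge_fair_slack_eq]), so all transfers agree and everyone is
indifferent.

The hypotheses being symmetric, let psi have at least the throughput of phi.
For a small t > 0 the flows (1 - t) phi + t psi and (1 - t) psi + t phi are
feasible for the problems of phi and psi respectively: between two edge flows
within capacity one stays within capacity, and whenever a node gains it has
room to. The throughput is affine in t, so maximality of phi makes
both throughputs equal, and both combinations are maximum flows. Suppose
phi <> psi, and among the edges where they differ let p be one at which
min(phi, psi) is least. Say phi p < psi p. Moving from phi towards psi
raises the flow on p, while any edge that loses flow stays above its value of
min(phi, psi), hence at or above phi p. That contradicts the max-min
optimality of phi (lemma [edge_fair_raise_lowers]). If psi p < phi p, moving
from psi towards phi contradicts the optimality of psi.

It remains to see that the iterative procedure produces a flow at all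
(lemma [edge_fair_output_nonempty]). Every set of flows it goes through is
compact, so each level is attained, and is stable under midpoints, so that
averaging shows that at least one edge is frozen in each step. *)

(** * Convex combinations of flows *)

Section Interpolation.
Variables (R : realType) (S D : finType) (E : {set S * D}).
Implicit Types (s : S -> R) (d : D -> R) (u : edge E -> \bar R).
Implicit Types (t x y c l : R) (phi psi : flow R E) (F : set (flow R E)).
Implicit Types (A : {set edge E}).

Definition conv t x y : R := (1 - t) * x + t * y.

Definition conv_flow t phi psi : flow R E :=
  [ffun e => conv t (phi e) (psi e)].

Lemma conv_ge t x y c : 0 <= t <= 1 -> c <= x -> c <= y -> c <= conv t x y.
Proof. by rewrite /conv => /andP[t0 t1] cx cy; nra. Qed.

Lemma conv_le t x y c : 0 <= t <= 1 -> x <= c -> y <= c -> conv t x y <= c.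
Proof. by rewrite /conv => /andP[t0 t1] xc yc; nra. Qed.

Lemma conv_gt t x y c : 0 < t < 1 -> c <= x -> c <= y -> c < x \/ c < y ->
  c < conv t x y.
Proof. by rewrite /conv => /andP[t0 t1] cx cy [?|?]; nra. Qed.

Lemma sum_conv (I : finType) (P : pred I) t (f g : I -> R) :
  \sum_(i | P i) conv t (f i) (g i) =
  conv t (\sum_(i | P i) f i) (\sum_(i | P i) g i).
Proof. by rewrite /conv big_split /= -!mulr_sumr. Qed.

Lemma supplied_conv t phi psi i :
  supplied (conv_flow t phi psi) i = conv t (supplied phi i) (supplied psi i).
Proof. by rewrite -sum_conv; apply: eq_bigr => e _; rewrite ffunE. Qed.

Lemma received_conv t phi psi j :
  received (conv_flow t phi psi) j = conv t (received phi j) (received psi j).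
Proof. by rewrite -sum_conv; apply: eq_bigr => e _; rewrite ffunE. Qed.

Definition throughput phi : R := \sum_(i : S) supplied phi i.

Lemma throughput_conv t phi psi :
  throughput (conv_flow t phi psi) = conv t (throughput phi) (throughput psi).
Proof. by rewrite -sum_conv; apply: eq_bigr => i _; rewrite supplied_conv. Qed.

(** Only the node constraints are at risk when moving towards a flow that is
feasible for other peaks: the edge constraints are those of the same network. *)
Lemma feasible_conv s d u s' d' t phi psi : 0 <= t <= 1 ->
    feasible s d u phi -> feasible s' d' u psi ->
    (forall i, conv t (supplied phi i) (supplied psi i) <= s i) ->
    (forall j, conv t (received phi j) (received psi j) <= d j) ->
  feasible s d u (conv_flow t phi psi).
Proof.
move=> t01 [phi0 phiu _ _] [psi0 psiu _ _] cs cd; split.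
- by move=> e; rewrite ffunE conv_ge.
- move=> e; rewrite ffunE; have [le_pp|/ltW le_pp] := lerP (phi e) (psi e).
    by apply: le_trans (psiu e); rewrite lee_fin conv_le.
  by apply: le_trans (phiu e); rewrite lee_fin conv_le.
- by move=> i; rewrite supplied_conv.
- by move=> j; rewrite received_conv.
Qed.

Definition midpoint_closed F :=
  forall phi psi, F phi -> F psi -> F (conv_flow 2^-1 phi psi).

Lemma half01 : 0 < (2^-1 : R) /\ (2^-1 : R) < 1.
Proof. by split; lra. Qed.

Lemma half_in01 : 0 <= (2^-1 : R) <= 1.
Proof. by have [? ?] := half01; rewrite !ltW. Qed.

Lemma max_flows_midpoint s d u : midpoint_closed (max_flows s d u).
Proof.
move=> phi psi [phiF phiM] [psiF psiM].
have [_ _ phis phid] := phiF; have [_ _ psis psid] := psiF.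
split; first by apply: feasible_conv phiF psiF _ _ => [|i|j];
  rewrite ?half_in01// conv_le ?half_in01.
move=> chi chiF; change (throughput chi <= throughput (conv_flow 2^-1 phi psi)).
by rewrite throughput_conv conv_ge ?half_in01 ?phiM ?psiM.
Qed.

Lemma next_flows_midpoint F A :
  midpoint_closed F -> midpoint_closed (next_flows F A).
Proof.
move=> mF phi psi [Fphi phiA] [Fpsi psiA]; split; first exact: mF.
by move=> e eA; rewrite ffunE conv_ge ?half_in01 ?phiA ?psiA.
Qed.

End Interpolation.

(** * Compactness, and attainment of the step levels *)

Section Compactness.
Variables (R : realType) (S D : finType) (E : {set S * D}).
Implicit Types (s : S -> R) (d : D -> R) (u : edge E -> \bar R).
Implicit Types (c l : R) (phi psi : flow R E) (F : set (flow R E)) (A : {set edge E}).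

Let prodR : topologicalType := prod_topology (fun _ : edge E => R).

(** Flows are finite functions and carry no topology; compactness is that of
the corresponding set of plain functions, with the product topology. *)
Definition flow_compact F : Prop :=
  compact ([set f | F (finfun f)] : set prodR).

Lemma edge_continuous (e : edge E) : continuous (fun f : prodR => f e).
Proof. exact: (@proj_continuous _ (fun _ => R) e). Qed.

Lemma sum_continuous (T : topologicalType) (I : finType) (P : pred I)
    (g : I -> T -> R) :
  (forall i, continuous (g i)) -> continuous (fun x => \sum_(i | P i) g i x).
Proof.
have addc : continuous (fun x : R * R => x.1 + x.2).
  by move=> x; exact: add_continuous.
by move=> gc; apply: (continuous_big addc) => i _; exact: gc.
Qed.

Lemma sum_edges_continuous (P : pred (edge E)) :
  continuous (fun f : prodR => \sum_(e | P e) (finfun f : flow R E) e).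
Proof.
have -> : (fun f : prodR => \sum_(e | P e) (finfun f : flow R E) e) =
    (fun f : prodR => \sum_(e | P e) f e).
  by apply/funext => g; apply: eq_bigr => e _; rewrite ffunE.
exact: (@sum_continuous _ _ P (fun e (f : prodR) => f e) edge_continuous).
Qed.

Lemma throughput_continuous :
  continuous (fun f : prodR => throughput (finfun f : flow R E)).
Proof.
apply: (@sum_continuous prodR S xpredT
  (fun i f => supplied (finfun f : flow R E) i)) => i.
exact: sum_edges_continuous.
Qed.

Lemma closed_le_fun (g : prodR -> R) c :
  continuous g -> closed [set f | g f <= c].
Proof. by move=> gc; apply: preimage_closed (@closed_le _ c) => f _; exact: gc. Qed.

Lemma closed_ge_fun (g : prodR -> R) c :
  continuous g -> closed [set f | c <= g f].
Proof. by move=> gc; apply: preimage_closed (@closed_ge _ c) => f _; exact: gc. Qed.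

Lemma closed_forall (T : topologicalType) (I : Type) (P : I -> set T) :
  (forall i, closed (P i)) -> closed [set x | forall i, P i x].
Proof.
move=> Pc; have -> : [set x | forall i, P i x] = \bigcap_i P i.
  by apply/seteqP; split => x Px i => [_|]; exact: Px.
by apply: closed_bigI => i _.
Qed.

Lemma closed_capacity (g : prodR -> R) (c : \bar R) :
  continuous g -> closed [set f | ((g f)%:E <= c)%E].
Proof.
move=> gc; case: c => [r| |].
- rewrite (_ : mkset _ = [set f | g f <= r]); first exact: closed_le_fun.
  by apply/seteqP; split => f /=; rewrite lee_fin.
- rewrite (_ : mkset _ = setT); first exact: closedT.
  by apply/seteqP; split => f //= _; rewrite leey.
- rewrite (_ : mkset _ = set0); first exact: closed0.
  by apply/seteqP; split => f //=; rewrite leeNy_eq.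
Qed.

Lemma feasible_le s d u phi e : feasible s d u phi -> phi e <= s (val e).1.
Proof.
move=> [phi0 _ phis _]; apply: le_trans (phis _).
by rewrite /supplied (bigD1 e)//= lerDl sumr_ge0.
Qed.

(** Edge capacities may be infinite, so boundedness comes from the supplier
peaks: the feasible flows are closed in a product of segments. *)
Lemma feasible_compact s d u : flow_compact (feasible s d u).
Proof.
have box : compact [set f : prodR | forall e, `[0, s (val e).1]%classic (f e)].
  apply: (@tychonoff _ (fun=> R) (fun e => `[0, s (val e).1]%classic)) => e.
  exact: segment_compact.
apply: subclosed_compact box _; last first.
  move=> f fF e; have := fF => -[/(_ e) + _ _ _]; have := feasible_le e fF.
  by rewrite ffunE /= in_itv/= => -> ->.
have -> : [set f | feasible s d u (finfun f)] =
    [set f : prodR | forall e, 0 <= f e] `&`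
    [set f | forall e, ((f e)%:E <= u e)%E] `&`
    [set f | forall i, supplied (finfun f) i <= s i] `&`
    [set f | forall j, received (finfun f) j <= d j].
  apply/seteqP; split => f /=.
    by move=> [f0 fu fs fd]; split=> //; split=> //; split => e;
      [have := f0 e | have := fu e]; rewrite ffunE.
  by move=> [[[f0 fu] fs] fd]; split => // e; rewrite ffunE.
apply: closedI; first apply: closedI; first apply: closedI.
- by apply: closed_forall => e; apply: closed_ge_fun; exact: edge_continuous.
- by apply: closed_forall => e; apply: closed_capacity; exact: edge_continuous.
- by apply: closed_forall => i; apply: closed_le_fun; exact: sum_edges_continuous.
- by apply: closed_forall => j; apply: closed_le_fun; exact: sum_edges_continuous.
Qed.

Lemma flow_attains_max F (g : prodR -> R) :
    flow_compact F -> continuous g -> F !=set0 ->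
  exists2 phi, F phi & forall psi, F psi -> g psi <= g phi.
Proof.
move=> cF gc [phi0 F0].
have [|f /set_mem Ff fmax] := compact_EVT_max _ cF (continuous_subspaceT gc).
- by exists (phi0 : edge E -> R); rewrite /= ffunK.
- exists (finfun f) => // psi Fpsi.
  have -> : finfun f = f :> (edge E -> R) by apply/funext => e; rewrite ffunE.
  by apply: fmax; apply/mem_set; rewrite /= ffunK.
Qed.

(** The minimum over the edges [e0 :: r], given through its lower bounds;
listing one edge separately keeps the minimum over a nonempty list. *)
Lemma min_edges (e0 : edge E) (r : seq (edge E)) :
  exists2 m : prodR -> R, continuous m &
    forall f l, l <= m f <-> l <= f e0 /\ {in r, forall e, l <= f e}.
Proof.
elim: r => [|e r [m mc mP]].
  exists (fun f => f e0) => [|f l]; first exact: edge_continuous.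
  by split => [|[]].
exists (fun f => Num.min (f e) (m f)) => [f|f l].
  by apply: continuous_min; [exact: edge_continuous|exact: mc].
rewrite le_min; split => [/andP[le /mP[le0 ler]]|[le0 ler]].
  by split => // e' /predU1P[->|/ler].
apply/andP; split; first by apply: ler; rewrite mem_head.
by apply/mP; split => // e' e'r; apply: ler; rewrite inE e'r orbT.
Qed.

Lemma max_flows_nonempty s d u : (forall i, 0 <= s i) -> (forall j, 0 <= d j) ->
  (forall e, 0 <= u e)%E -> max_flows s d u !=set0.
Proof.
move=> s0 d0 u0.
have F0 : feasible s d u [ffun=> 0].
  split=> [e|e|i|j]; rewrite ?ffunE//.
    by rewrite /supplied big1// => e _; rewrite ffunE.
  by rewrite /received big1// => e _; rewrite ffunE.
have [phi Fphi phimax] := flow_attains_max (feasible_compact (s:=s) (d:=d) (u:=u))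
  throughput_continuous (ex_intro _ _ F0).
exists phi; split=> // psi /phimax.
by rewrite !ffunK.
Qed.

Lemma max_flows_compact s d u : flow_compact (max_flows s d u).
Proof.
rewrite /flow_compact.
have [[phi [Fphi phimax]]|] := pselect (max_flows s d u !=set0); last first.
  move=> /set0P/negP; rewrite negbK => /eqP ->.
  by rewrite (_ : mkset _ = set0) //; exact: compact0.
have -> : [set f | max_flows s d u (finfun f)] =
    [set f : prodR | feasible s d u (finfun f)] `&`
    [set f | throughput phi <= throughput (finfun f)].
  apply/seteqP; split => f /= [Ff fmax]; split=> //; first exact: fmax.
  by move=> psi /phimax /le_trans; apply.
by apply: compact_closedI; [exact: feasible_compact|
  apply: closed_ge_fun; exact: throughput_continuous].
Qed.

Lemma next_flows_compact F A : flow_compact F -> flow_compact (next_flows F A).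
Proof.
move=> cF; rewrite /flow_compact.
have -> : [set f | next_flows F A (finfun f)] = [set f : prodR | F (finfun f)] `&`
    [set f | forall e, e \in A -> edge_level F A <= f e].
  apply/seteqP; split => f /= [Ff fA]; split=> // e eA; have := fA e eA;
  by rewrite ffunE.
apply: compact_closedI => //.
apply: (closed_forall (P := fun e => [set f : prodR | e \in A -> _ <= f e])) => e.
have [eA|/negP eA] := boolP (e \in A).
  rewrite (_ : mkset _ = [set f | edge_level F A <= f e]).
    by apply: closed_ge_fun; exact: edge_continuous.
  by apply/seteqP; split => f /=; auto.
rewrite (_ : mkset _ = setT); first exact: closedT.
by apply/seteqP; split.
Qed.

(** The supremum defining [edge_level] is a maximum: the minimum flow over [A]
is continuous, so it is maximized by some flow of the compact set [F], and that
flow is admissible in the next step. The second part is what makes the level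
usable, as the supremum of an unbounded set would be meaningless. *)
Lemma edge_levelP F A e0 : flow_compact F -> F !=set0 -> e0 \in A ->
  next_flows F A !=set0 /\
  forall phi l, F phi -> (forall e, e \in A -> l <= phi e) -> l <= edge_level F A.
Proof.
move=> cF F0 e0A; have [m mc mP] := min_edges e0 (enum A).
have {}mP (f : edge E -> R) l : l <= m f <-> forall e, e \in A -> l <= f e.
  rewrite mP; split => [[_ fA] e eA|fA]; first by apply: fA; rewrite mem_enum.
  by split; [exact: fA|move=> e; rewrite mem_enum => /fA].
have [phi Fphi phimax] := flow_attains_max cF mc F0.
have ubl : ubound [set l | exists2 phi, F phi & forall e, e \in A -> l <= phi e]
    (m phi).
  by move=> l [psi Fpsi /mP /le_trans]; apply; exact: phimax.
split.
  exists phi; split => //; apply/mP; apply: ge_sup => //.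
  by exists (m phi), phi => //; exact/mP.
move=> psi l Fpsi psiA; apply: ub_le_sup; first by exists (m phi).
by exists psi.
Qed.

End Compactness.

(** * The procedure terminates with a flow *)

Section EdgeFair.
Variables (R : realType) (S D : finType) (E : {set S * D}).
Implicit Types (s : S -> R) (d : D -> R) (u : edge E -> \bar R).
Implicit Types (phi psi : flow R E) (F : set (flow R E)).
Implicit Types (A : {set edge E}).

(** If every active edge could exceed the level, each through a flow of its
own, midpoints would combine these into one flow exceeding the level on all
active edges at once, and the level would not be optimal. *)
Lemma next_edges_proper F A : flow_compact F -> midpoint_closed F -> F !=set0 ->
  A != finset.set0 -> next_edges F A \proper A.
Proof.
move=> cF mF F0 /set0Pn[e0 e0A].
have [[phi0 Fphi0] levelP] := edge_levelP cF F0 e0A.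
rewrite properE; apply/andP; split; first by apply/fintype.subsetP => e; rewrite inE => /andP[].
apply/negP => /fintype.subsetP subA.
have above (r : seq (edge E)) : {subset r <= A} ->
    exists2 phi, next_flows F A phi & {in r, forall e, edge_level F A < phi e}.
  (* A midpoint is above the level wherever one of its two flows is. *)
  elim: r => [|e r IHr] rA; first by exists phi0.
  have [phi Fphi phir] := IHr (fun e' e'r => rA e' (mem_behead (s := e :: r) e'r)).
  have eA : e \in A by apply: rA; rewrite mem_head.
  have := subA e eA; rewrite inE eA /= => /asboolP[psi Fpsi psie].
  exists (conv_flow 2^-1 phi psi); first exact: next_flows_midpoint.
  move=> e' e'r; have e'A := rA _ e'r.
  rewrite ffunE conv_gt ?(proj2 Fphi) ?(proj2 Fpsi)//.
    by have [-> ->] := half01 R.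
  by move: e'r => /predU1P[->|/phir]; [right|left].
have [e|phi [Fphi _] phiA] := above (enum A); first by rewrite mem_enum.
have phi_gt e : e \in A -> edge_level F A < phi e by rewrite -mem_enum => /phiA.
have [m mA m_min] := arg_minP phi e0A.
by have := levelP phi (phi m) Fphi m_min; rewrite leNgt phi_gt.
Qed.

Lemma edge_fair_state_regular s d u t :
    (forall i, 0 <= s i) -> (forall j, 0 <= d j) -> (forall e, 0 <= u e)%E ->
  [/\ flow_compact (edge_fair_state s d u t).1,
      midpoint_closed (edge_fair_state s d u t).1 &
      (edge_fair_state s d u t).1 !=set0].
Proof.
move=> s0 d0 u0; elim: t => [|t] /=.
  split; [exact: max_flows_compact|exact: max_flows_midpoint|].
  exact: max_flows_nonempty.
case: edge_fair_state => F A /= [cF mF F0].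
have [//|/set0Pn[e0 e0A]] := eqVneq A finset.set0; split => /=.
- exact: next_flows_compact.
- exact: next_flows_midpoint.
- by have [] := edge_levelP cF F0 e0A.
Qed.

Lemma edge_fair_output_nonempty s d u :
    (forall i, 0 <= s i) -> (forall j, 0 <= d j) -> (forall e, 0 <= u e)%E ->
  edge_fair_output s d u !=set0.
Proof.
move=> s0 d0 u0; suff [t At] : exists t, (edge_fair_state s d u t).2 = finset.set0.
  by have [_ _ [phi Fphi]] := edge_fair_state_regular t s0 d0 u0; exists phi, t.
suff /(_ _ 0%N (leqnn _)) : forall n t, (#|(edge_fair_state s d u t).2| <= n)%N ->
  exists t, (edge_fair_state s d u t).2 = finset.set0 by [].
elim=> [|n IHn] t; first by rewrite leqn0 cards_eq0 => /eqP; exists t.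
have [/eqP|An0 ltAn] := boolP ((edge_fair_state s d u t).2 == finset.set0).
  by exists t.
apply: (IHn t.+1); rewrite -ltnS; apply: leq_trans ltAn.
have [] := edge_fair_state_regular t s0 d0 u0.
move: An0 => /=; case: edge_fair_state => F A /= An0 cF mF F0.
by rewrite (negPf An0)/= proper_card// next_edges_proper.
Qed.

(** * Local optimality of the edge-fair flow *)

Lemma edge_fair_state_max s d u t phi :
  (edge_fair_state s d u t).1 phi -> max_flows s d u phi.
Proof.
elim: t => [//|t] /=; case: edge_fair_state => F A /= IHt.
by case: ifP => // _ [/IHt].
Qed.

(** The max-min property that the proof uses: raising the flow on [p] within
the maximum flows costs some edge that ends up below [phi p]. Otherwise [psi]
would survive every step as long as [p] is active, since the level is at most
[phi p]; and [psi p > phi p] would then keep [p] active forever. *)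
Lemma edge_fair_raise_lowers s d u phi psi p :
    edge_fair_output s d u phi -> max_flows s d u psi -> phi p < psi p ->
  exists2 e, psi e < phi e & psi e < phi p.
Proof.
move=> [t [At Ft]] psimax lt_p; apply: contrapT => no_e.
have keep e : psi e < phi e -> phi p <= psi e.
  by move=> lt_e; rewrite leNgt; apply/negP => ?; apply: no_e; exists e.
suff /(_ t Ft) [_] : forall t, (edge_fair_state s d u t).1 phi ->
    (edge_fair_state s d u t).1 psi /\ p \in (edge_fair_state s d u t).2.
  by rewrite At inE.
elim=> {t At Ft} [_|t] /=; first by rewrite inE.
case: edge_fair_state => F A /= IHt; case: ifP => [//|_] /= [/IHt[Fpsi pA] phiA].
have Npsi : next_flows F A psi.
  split=> // e eA; have [/keep|] := ltP (psi e) (phi e).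
    by apply: le_trans; exact: phiA.
  by apply: le_trans; exact: phiA.
split=> //; rewrite inE pA; apply/asboolP; exists psi => //.
by apply: le_lt_trans lt_p; exact: phiA.
Qed.

(** * Two edge-fair flows that leave each other room to move *)

Lemma near_conv_le (x y c : R) : x <= c -> (x < y -> x < c) ->
  \forall t \near 0^'+, conv t x y <= c.
Proof.
move=> xc xyc; have [yx|xy] := leP y x.
  near=> t; have t0 : 0 < t by near: t; exact: nbhs_right_gt.
  by rewrite /conv; nra.
have yx0 : 0 < y - x by rewrite subr_gt0.
have /nbhs_right_le : 0 < (c - x) / (y - x) by rewrite divr_gt0 ?subr_gt0 ?xyc.
by apply: filterS => t; rewrite ler_pdivlMr// /conv; nra.
Unshelve. all: by end_near. Qed.

(** The same for a move towards an arbitrary flow [psi]; the loss is then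
read off from [phi] and [psi], independently of the length [t] of the move. *)
Lemma edge_fair_move_lowers s d u (t : R) phi psi p :
    edge_fair_output s d u phi -> 0 < t < 1 ->
    max_flows s d u (conv_flow t phi psi) -> phi p < psi p ->
  exists2 e, phi e != psi e & Num.min (phi e) (psi e) < phi p.
Proof.
move=> phiO t01 psi'M lt_p.
have lt_p' : phi p < conv_flow t phi psi p.
  by rewrite ffunE conv_gt ?(ltW lt_p)//; right.
have [e] := edge_fair_raise_lowers phiO psi'M lt_p'; rewrite ffunE => lt_e lt_pe.
exists e.
  by apply: contraTneq lt_e => <-; rewrite /conv -mulrDl subrK mul1r ltxx.
apply: contraTT lt_pe; rewrite -!leNgt le_min => /andP[le1 le2].
by apply: conv_ge => //; case/andP: t01 => /ltW -> /ltW ->.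
Qed.

(** Steps towards each other keep [phi] and [psi] maximum flows of their own
problems, and this contradicts the optimality of one of them at an edge where
they differ and their minimum is least. *)
Lemma edge_fair_slack_eq_le s d u s' d' phi psi :
    edge_fair_output s d u phi -> edge_fair_output s' d' u psi ->
    (forall i, supplied phi i < supplied psi i -> supplied phi i < s i) ->
    (forall i, supplied psi i < supplied phi i -> supplied psi i < s' i) ->
    (forall j, received phi j < received psi j -> received phi j < d j) ->
    (forall j, received psi j < received phi j -> received psi j < d' j) ->
    throughput phi <= throughput psi ->
  phi = psi.
Proof.
move=> phiO psiO sl sr dl dr le_pp.
have [? [_ /edge_fair_state_max[phiF phiM]]] := phiO.
have [? [_ /edge_fair_state_max[psiF psiM]]] := psiO.
have [_ _ phis phid] := phiF; have [_ _ psis psid] := psiF.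
have [t [[t0 t1] [cs cs' cd cd']]] : exists t : R, (0 < t /\ t <= 2^-1) /\
  [/\ forall i, conv t (supplied phi i) (supplied psi i) <= s i,
      forall i, conv t (supplied psi i) (supplied phi i) <= s' i,
      forall j, conv t (received phi j) (received psi j) <= d j &
      forall j, conv t (received psi j) (received phi j) <= d' j].
  apply: (@filter_ex _ (0 : R)^'+); near=> t; split; [split|split].
  - by near: t; exact: nbhs_right_gt.
  - by near: t; apply: nbhs_right_le; have [] := half01 R.
  - by near: t; apply: filter_forall => i; apply: near_conv_le; auto.
  - by near: t; apply: filter_forall => i; apply: near_conv_le; auto.
  - by near: t; apply: filter_forall => i; apply: near_conv_le; auto.
  - by near: t; apply: filter_forall => i; apply: near_conv_le; auto.
have t01 : 0 < t < 1 by lra.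
have t01w : 0 <= t <= 1 by lra.
have phi'F : feasible s d u (conv_flow t phi psi).
  exact: feasible_conv phiF psiF cs cd.
have psi'F : feasible s' d' u (conv_flow t psi phi).
  exact: feasible_conv psiF phiF cs' cd'.
(* A larger throughput of [psi] would let [phi] be improved. *)
have eq_pp : throughput phi = throughput psi.
  have : throughput (conv_flow t phi psi) <= throughput phi by exact: phiM.
  by rewrite throughput_conv /conv; nra.
have phi'M : max_flows s d u (conv_flow t phi psi).
  split=> // chi /phiM; change (throughput chi <= throughput phi ->
    throughput chi <= throughput (conv_flow t phi psi)).
  by rewrite throughput_conv -eq_pp /conv -mulrDl subrK mul1r.
have psi'M : max_flows s' d' u (conv_flow t psi phi).
  split=> // chi /psiM; change (throughput chi <= throughput psi ->
    throughput chi <= throughput (conv_flow t psi phi)).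
  by rewrite throughput_conv eq_pp /conv -mulrDl subrK mul1r.
apply/ffunP => e; apply/eqP; apply: contrapT => /negP neq_e.
have [p p_neq p_min] :=
  arg_minP (P := [pred e | phi e != psi e]) (fun e => Num.min (phi e) (psi e)) neq_e.
have [lt_p|lt_p|/eqP] := ltgtP (phi p) (psi p); last by rewrite (negPf p_neq).
- have [e' /p_min + ] := edge_fair_move_lowers phiO t01 phi'M lt_p.
  by rewrite (min_l (ltW lt_p)) leNgt => /negP.
- have [e'] := edge_fair_move_lowers psiO t01 psi'M lt_p.
  rewrite eq_sym minC => /p_min.
  by rewrite (min_r (ltW lt_p)) leNgt => /negP.
Unshelve. all: by end_near. Qed.

(** Peaks enter only through the room they leave at nodes where the two flows
differ, so two problems need not be related otherwise. Uniqueness of the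
edge-fair flow is the case of equal peaks. *)
Lemma edge_fair_slack_eq s d u s' d' phi psi :
    edge_fair_output s d u phi -> edge_fair_output s' d' u psi ->
    (forall i, supplied phi i < supplied psi i -> supplied phi i < s i) ->
    (forall i, supplied psi i < supplied phi i -> supplied psi i < s' i) ->
    (forall j, received phi j < received psi j -> received phi j < d j) ->
    (forall j, received psi j < received phi j -> received psi j < d' j) ->
  phi = psi.
Proof.
move=> phiO psiO sl sr dl dr.
have [le_pp|/ltW le_pp] := leP (throughput phi) (throughput psi).
  exact: (edge_fair_slack_eq_le phiO psiO).
by apply/esym; exact: (edge_fair_slack_eq_le psiO phiO).
Qed.

End EdgeFair.

(** * Single-peaked preferences and the coalition *)

Lemma sp_weak_peak (R : realType) (P : sp_pref R) x :
  sp_weak P x (sp_peak P) -> 0 <= x -> x = sp_peak P.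
Proof.
move=> xP x0; have [lt_x|lt_x|//] := ltgtP x (sp_peak P).
  by have [] := sp_below_peak x0 lt_x (lexx _).
by have [] := sp_above_peak (lexx _) lt_x.
Qed.

Lemma sp_indiff_refl (R : realType) (P : sp_pref R) x : 0 <= x -> sp_indiff P x x.
Proof. by move=> x0; have [] := sp_total P x0 x0. Qed.

(** [x] is an agent's transfer at the truth, [y] after the deviation, and [inA]
tells whether the agent belongs to the coalition. A member at its peak in [x]
can only accept [y = x], so one that gains was below its peak; and no member
accepts less than [x], so one that loses is an outsider, whose peak is
unchanged. *)
Lemma sp_slack (R : realType) (P Q : sp_pref R) (inA : bool) x y :
    0 <= x <= sp_peak P ->
    0 <= y <= sp_peak (if inA then Q else P) ->
    (inA -> sp_weak P y x) ->
  (x < y -> x < sp_peak P) /\ (y < x -> y < sp_peak (if inA then Q else P)).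
Proof.
move=> /andP[x0 xP] /andP[y0 yQ] better; split=> lt_xy.
  rewrite lt_neqAle xP andbT; apply: contraTneq lt_xy => eq_x.
  case: inA better yQ => [/(_ isT)|_]; last by rewrite -leNgt eq_x.
  by rewrite eq_x => /sp_weak_peak -> //; rewrite ltxx.
case: inA better yQ => [/(_ isT) yx|_ _]; last exact: lt_le_trans xP.
by have [] := sp_below_peak y0 lt_xy xP.
Qed.

Theorem corollary1 (R : realType) (S D : finType) (E : {set S * D})
    (u : edge E -> \bar R) (u_ge0 : forall e : edge E, (0 <= u e)%E) :
  group_strategyproof (edge_fair_transfer u).
Proof.
have fairP (P : profile R (S + D)%type) :
    let s i := sp_peak (P (inl i)) in let d j := sp_peak (P (inr j)) in
    edge_fair_output s d u (edge_fair_flow s d u).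
  move=> s d; rewrite /edge_fair_flow.
  have [phi phiO] : edge_fair_output s d u !=set0.
    by apply: edge_fair_output_nonempty => // [i|j]; exact: sp_peak_ge0.
  exact: xgetI phiO.
have transferP (P : profile R (S + D)%type) a :
    0 <= edge_fair_transfer u P a <= sp_peak (P a).
  have [t [_ /edge_fair_state_max[[phi0 _ phis phid] _]]] := fairP P.
  by case: a => [i|j] /=; rewrite ?phis ?phid andbT sumr_ge0.
move=> P Q A better a aA.
have slack b := sp_slack (transferP P b) (transferP (deviate A Q P) b) (better b).
suff -> : edge_fair_transfer u (deviate A Q P) a = edge_fair_transfer u P a.
  by apply: sp_indiff_refl; have /andP[] := transferP P a.
rewrite /edge_fair_transfer -(edge_fair_slack_eq (fairP P) (fairP (deviate A Q P))) //.
- by move=> i; have [] := slack (inl i).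
- by move=> i; have [] := slack (inl i).
- by move=> j; have [] := slack (inr j).
- by move=> j; have [] := slack (inr j).
Qed.
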